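(* Assume the Continuum Hypothesis. Let $(X,\tau)$ be a productively quasi-Lindelöf space such that every open cover of $X^\omega$ has a point-$\mathfrak{c}$ refinement consisting of basic open sets. Then $X$ is powerfully quasi-Lindelöf.
   Context: The Continuum Hypothesis is the statement $2^{\aleph_0}=\aleph_1$, and $\mathfrak{c}=2^{\aleph_0}$. A space is an arbitrary topological space unless separation axioms are stated. A space is quasi-Lindelöf if every open cover of it has a countable subcover (no separation axioms). A space is Lindelöf if it is regular (which includes $\mathsf{T}_1$) and quasi-Lindelöf. A space $X$ is productively quasi-Lindelöf if $X\times Y$ is quasi-Lindelöf for every Lindelöf space $Y$. A space $X$ is powerfully quasi-Lindelöf if $X^\omega$ (with the product topology) is quasi-Lindelöf. A set $U\subseteq X^\omega$ is a basic open set if $U=\prod_{i\in\omega}V_i$, where each $V_i$ is an open subset of $X$ and $V_i=X$ for all but finitely many $i$. A family $\mathcal{W}$ of subsets of a set $S$ is point-$\kappa$ if $|\{W\in\mathcal{W}:x\in W\}|\leq\kappa$ for every $x\in S$. A refinement of a cover $\mathcal{U}$ is a cover $\mathcal{W}$ of the same space such that every element of $\mathcal{W}$ is contained in some element of $\mathcal{U}$. *)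

(* Defs.v *)
From mathcomp Require Import all_boot.
From mathcomp Require Import all_classical topology.
From mathcomp Require wochoice.

Set Implicit Arguments.
Unset Strict Implicit.
Unset Printing Implicit Defensive.

Local Open Scope classical_set_scope.
Local Open Scope card_scope.

(* [R] is a well-order (in its reflexive form) of order type omega_1, the first
   uncountable ordinal. *)
Definition is_omega1 (T : Type) (R : rel T) : Prop :=
  [/\ wochoice.well_order R,
      ~ countable [set: T]
    & forall x : T, countable [set y | R y x /\ y <> x]].

Definition has_card_aleph1 (S : Type) (A : set S) : Prop :=
  exists (T : Type) (R : rel T), is_omega1 R /\ A #= [set: T].

(* A set of cardinality 2 ^ aleph_0. *)
Definition continuum : set (set nat) := [set: set nat].

Definition continuum_hypothesis : Prop := has_card_aleph1 continuum.

Definition is_cover (S : Type) (C : set (set S)) : Prop :=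
  \bigcup_(U in C) U = [set: S].

Definition open_cover (X : topologicalType) (C : set (set X)) : Prop :=
  C `<=` open /\ is_cover C.

Definition refinement (S : Type) (W C : set (set S)) : Prop :=
  is_cover W /\ forall A, W A -> exists2 U, C U & A `<=` U.

(* [point_le W K]: the family [W] is point-kappa, where kappa is the cardinality
   of [K]. *)
Definition point_le (S K' : Type) (W : set (set S)) (K : set K') : Prop :=
  forall x : S, [set A | W A /\ A x] #<= K.

Definition quasi_lindelof (X : topologicalType) : Prop :=
  forall C : set (set X), open_cover C ->
    exists C' : set (set X), [/\ C' `<=` C, countable C' & is_cover C'].

(* [accessible_space] is T1; [regular_space] alone does not include it. *)
Definition lindelof (Y : topologicalType) : Prop :=
  [/\ accessible_space Y, @regular_space Y & quasi_lindelof Y].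

Definition productively_quasi_lindelof (X : topologicalType) : Prop :=
  forall Y : topologicalType, lindelof Y -> quasi_lindelof (X * Y)%type.

Definition powerfully_quasi_lindelof (X : topologicalType) : Prop :=
  quasi_lindelof {ptws nat -> X}.

Definition basic_open (X : topologicalType) (U : set {ptws nat -> X}) : Prop :=
  exists V : nat -> set X,
    [/\ forall i, open (V i),
        finite_set [set i | V i <> [set: X]]
      & U = [set f | forall i, V i (f i)]].

(* Main.v *)
Require Import Defs.
From HB Require Import structures.
From mathcomp Require Import all_boot.
From mathcomp Require Import all_classical topology.
Local Open Scope classical_set_scope.

(** The theorem rests on a theorem of Alster: under the Continuum Hypothesis, a
    family of G_delta subsets of a productively Lindelof space of weight at most
    omega_1 covers the space by countably many of its members as soon as every
    compact subset lies in one of them.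

    Let [B] be a family of open subsets of [X] indexed by omega_1.  A point of
    [X] is replaced by the set of indices of the members of [B] missing it, and
    more generally one considers the subspace [V] of the cube 2^omega_1 formed
    by the sets of indices whose members do not cover [X] (or a closed subset
    [F] of [X]).  Points of the cube outside [V] are covers of [F].  For a
    Lindelof set [Y] of covers, the product of [X] and [Y] is quasi-Lindelof,
    and this says that countably many indices suffice to tell [Y] from [V]
    (lemma [separation]).  All of the argument consists in constructing
    suitable [Y].

    A first choice of [Y] shows that the projection of [V] to countably many
    coordinates is sigma-compact (lemma [sat_sigma_compact]).  For the theorem
    of Alster (lemma [alster]), enumerate in type omega_1 the small closed sets
    depending on countably many coordinates, where small refers to a given
    sigma-ideal, and let [Y] consist of the points separated from [V] at a
    countable stage before they enter a small set listed so far.  The crucial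
    point is that a closed set disjoint from [Y] is contained in a countable
    union of small sets (lemma [closed_caught]); this is a Baire category
    argument inside the projection to a well chosen countable stage.  It
    implies that [Y] is Lindelof, and then that [V] is small.

    Now let boxes with sides in [B] cover the power of [F] and suppose that
    countably many of them never suffice.  Applied once for each coordinate,
    the theorem of Alster gives closed, hence compact, subsets of [V] such that
    no product of G_delta neighbourhoods of finitely many of them can be
    covered by countably many boxes; but their full product is compact (lemma
    [box_countable_subcover]).

    Finally the point-continuum refinement reduces an arbitrary cover to this
    case: closing off a point under countable operations yields a set [A] of
    size continuum whose closure plays the role of [F], the boxes being those
    that meet the power of [A] (lemma [point_continuum_subcover]). *)

Set Implicit Arguments.
Unset Strict Implicit.
Unset Printing Implicit Defensive.

(** * The Cantor cube *)

Section Cube.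
Variable J : choiceType.
Implicit Types (s : seq (J * bool)) (u v : J -> bool) (C : set (J -> bool)).

Definition cyl s : set (J -> bool) := [set u | all (fun p => u p.1 == p.2) s].

Definition supp (D : set J) s : Prop := all (fun p => `[< D p.1 >]) s.

Definition agree (D : set J) u v := forall i, D i -> u i = v i.

(** Closedness in the product topology, read off the base of cylinders. *)
Definition cylclosed C := forall u, ~ C u -> exists2 s, cyl s u & cyl s `<=` ~` C.

Definition cyls (S : set (seq (J * bool))) := \bigcup_(s in S) cyl s.

Lemma cyl_cat s t : cyl (s ++ t) = cyl s `&` cyl t.
Proof.
by apply/seteqP; split=> u; rewrite /cyl /= all_cat => /andP.
Qed.

Lemma supp_cat D s t : supp D s -> supp D t -> supp D (s ++ t).
Proof. by rewrite /supp all_cat => -> ->. Qed.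

Lemma supp_sub D D' s : D `<=` D' -> supp D s -> supp D' s.
Proof. by move=> sD; apply: sub_all => p /asboolP /sD ?; apply/asboolP. Qed.

Lemma cyl_agree D s u v : supp D s -> agree D u v -> cyl s u -> cyl s v.
Proof.
move=> + a; elim: s => //= p s ih /andP[/asboolP Dp /ih {}ih] /andP[/eqP e cs].
by apply/andP; split; [rewrite -a// e|exact: ih].
Qed.

Lemma agree_sub D D' u v : D `<=` D' -> agree D' u v -> agree D u v.
Proof. by move=> sD a i /sD /a. Qed.

Lemma agree_sym D u v : agree D u v -> agree D v u.
Proof. by move=> a i Di; rewrite a. Qed.

Lemma agree_trans D u v w : agree D u v -> agree D v w -> agree D u w.
Proof. by move=> a b i Di; rewrite a ?b. Qed.

Definition gcyl u (l : seq J) := [seq (i, u i) | i <- l].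

Lemma gcylE u l v : cyl (gcyl u l) v <-> {in l, forall i, v i = u i}.
Proof.
rewrite /cyl /gcyl /= all_map; split.
  by move=> /allP h i il; apply/eqP/(h i il).
by move=> h; apply/allP => i il /=; apply/eqP/h.
Qed.

Lemma cyl_open s : open (cyl s : set {ptws J -> bool}).
Proof.
elim: s => [|[i b] s ih].
  by rewrite (_ : cyl [::] = setT) ?predeqE//; exact: openT.
have -> : cyl ((i, b) :: s) = (proj i @^-1` [set b]) `&` cyl s.
  apply/seteqP; split=> u; rewrite /cyl /proj /=; first by case/andP=> /eqP.
  by case=> -> ->; rewrite eqxx.
apply: openI => //; apply: open_comp; last exact: discrete_open.
by move=> x _; exact: proj_continuous.
Qed.

(** Compactness of the cube.  Covering the complement of [C] by the cylinders
    that miss [C] turns a cover of [C] into a cover of the whole cube. *)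
Lemma cyl_compact C : cylclosed C -> forall S, C `<=` cyls S ->
  exists2 L : seq (seq (J * bool)), (forall s, s \in L -> S s) &
    C `<=` cyls [set` L].
Proof.
move=> cC S CS.
have cT : compact [set: {ptws J -> bool}].
  have := @tychonoff J (fun _ => bool) (fun _ => setT) (fun _ => bool_compact).
  by rewrite (_ : (fun f => _) = setT)//; apply/seteqP; split.
pose D := S `|` [set s | cyl s `<=` ~` C].
(* Finite lists of members of D, directed by inclusion. *)
pose fin (L : seq (seq (J * bool))) := forall s, s \in L -> D s.
pose F : set_system (seq (seq (J * bool))) :=
  [set A | exists2 L, fin L & forall L', {subset L <= L'} -> A L'].
have FF : Filter F.
  split; first by exists [::].
    move=> A B [L fL LA] [L' fL' LB]; exists (L ++ L').
      by move=> s; rewrite mem_cat => /orP[/fL|/fL'].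
    move=> M LM; split; [apply: LA|apply: LB] => s sL; apply: LM.
      by rewrite mem_cat sL.
    by rewrite mem_cat sL orbT.
  by move=> A B AB [L fL LA]; exists L => // M /LA /AB.
have [|L LD LC] := (compact_near_coveringP _).1 cT _ F (fun L => cyls [set` L]) FF.
  move=> u _; have [s Ds su] : exists2 s, D s & cyl s u.
    have [/CS [s Ss su]|/cC [s su sC]] := pselect (C u); exists s => //; first by left.
    by right.
  exists (cyl s, [set L | s \in L]).
    split; first by apply: open_nbhs_nbhs; split => //; exact: cyl_open.
    exists [:: s]; first by move=> t; rewrite inE => /eqP ->.
    by move=> L'; apply; rewrite mem_head.
  by move=> [v L] /= [sv sL]; exists s.
have {}LC := LC L (fun _ => id).
exists [seq s <- L | `[< S s >]].
  by move=> s; rewrite mem_filter => /andP[/asboolP].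
move=> u Cu; have [s sL su] := LC u I; exists s => //=.
rewrite mem_filter sL andbT; apply/asboolP.
by have [//|/(_ u su)] := LD s sL.
Qed.

Lemma cylclosed_cyl s : cylclosed (cyl s).
Proof.
move=> u su; exists (gcyl u (unzip1 s)); first by apply/gcylE.
move=> v /gcylE vu; apply: contra_not su; rewrite /cyl /=.
move=> /allP vs; apply/allP => p ps; rewrite -vu ?vs//.
by apply/mapP; exists p.
Qed.

Lemma cylclosedI C C' : cylclosed C -> cylclosed C' -> cylclosed (C `&` C').
Proof.
move=> cC cC' u; rewrite /setI /= not_andE => -[/cC|/cC'] [s su sC]; exists s => //.
  by move=> v /sC vC [].
by move=> v /sC vC [].
Qed.

Lemma cylclosed_agree D u : cylclosed (agree D u).
Proof.
move=> v /existsNP [i /not_implyP[Di uv]].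
exists (gcyl v [:: i]); first exact/gcylE.
by move=> w /gcylE wv /(_ _ Di); rewrite (wv i) ?mem_head.
Qed.

Lemma cylclosed_setCcyls S : cylclosed (~` cyls S).
Proof.
by move=> u /contrapT [s Ss su]; exists s => // v sv; apply; exists s.
Qed.

Lemma supp_gcyl D u l : (forall i, i \in l -> D i) -> supp D (gcyl u l).
Proof.
move=> lD; rewrite /supp /gcyl all_map; apply/allP => i /lD Di /=.
exact/asboolP.
Qed.

(** The closed conditions [v i = u i], for [i] in [D], have the finite
    intersection property on [C]. *)
Lemma cyl_fip D C u : cylclosed C ->
  (forall s, supp D s -> cyl s u -> C `&` cyl s !=set0) ->
  exists2 v, C v & agree D u v.
Proof.
move=> cC h; apply: contrapT => /forall2NP nv.
pose S : set (seq (J * bool)) := [set s | exists2 i, D i & s = [:: (i, ~~ u i)]].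
have [|L LS LC] := cyl_compact cC (S := S).
  move=> v Cv; have [//|/existsNP [i /not_implyP [Di uv]]] := nv v.
  exists [:: (i, ~~ u i)]; first by exists i.
  by rewrite /cyl /= andbT; case: (u i) (v i) uv => [] [].
have LD l : l \in L -> exists2 i, D i & l = [:: (i, ~~ u i)] by move/LS.
pose is_ := [seq p.1 | p <- flatten L].
have [] := h (gcyl u is_); [apply: supp_gcyl | exact/gcylE |].
  move=> i /mapP [p /flattenP [l lL pl] ->].
  by have [j Dj e] := LD _ lL; move: pl; rewrite e inE => /eqP ->.
move=> v [Cv /gcylE vu]; have [l lL] := LC _ Cv.
have [j Dj e] := LD _ lL; rewrite e /cyl /= andbT vu; first by case: (u j).
apply/mapP; exists (j, ~~ u j) => //; apply/flattenP; exists l => //.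
by rewrite e mem_head.
Qed.

(** Finitely many members cover the compact fibre of [u] over [D]; if they
    covered no cylinder around the fibre with support in [D], the closed
    complement of their union would meet the fibre. *)
Lemma agree_cover D u S : agree D u `<=` cyls S ->
  exists s, [/\ supp D s, cyl s u &
    exists2 L : seq (seq (J * bool)), (forall s, s \in L -> S s) &
      cyl s `<=` cyls [set` L]].
Proof.
move=> uS; have [L LS LC] := cyl_compact (cylclosed_agree (D := D) (u := u)) uS.
apply: contrapT => nex.
have [s Ds su|v nv uv] := cyl_fip (D := D) (u := u) (cylclosed_setCcyls (S := [set` L])).
  apply: contrapT => e; apply: nex; exists s; split => //; exists L => // v sv.
  by apply: contrapT => nv; apply: e; exists v.
by apply: nv; apply: LC.
Qed.

End Cube.

(** * Closed sets depending on countably many coordinates *)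

Lemma countable_enum (U : Type) (A : set U) : countable A ->
  exists c : nat -> option U, forall a, A a <-> exists n, c n = Some a.
Proof.
move=> /countable_injP [f finj].
pose P n a := A a /\ f a = n.
exists (fun n => if pselect (exists a, P n a) is left e then Some (sval (cid e)) else None).
move=> a; split=> [Aa|[n]].
  exists (f a); case: pselect => [e|[]]; last by exists a.
  by case: cid => b [Ab fb] /=; congr Some; apply: finj; rewrite ?inE.
by case: pselect => // e [<-]; case: cid => b [].
Qed.

Lemma countable_inj_on (U V : Type) (f : U -> V) (A : set U) (B : set V) :
  countable B -> (forall x, A x -> B (f x)) ->
  (forall x y, A x -> A y -> f x = f y -> x = y) -> countable A.
Proof.
move=> /countable_injP [g ginj] AB finj; apply/countable_injP.
exists (g \o f) => x y; rewrite !inE => Ax Ay /= e.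
by apply: finj => //; apply: ginj; rewrite ?inE //; exact: AB.
Qed.

Lemma countable_imageT (U V : Type) (f : U -> V) (A : set U) :
  countable A -> countable (f @` A).
Proof. exact/sub_countable/card_image_le. Qed.

Lemma countableU (U : Type) (A B : set U) :
  countable A -> countable B -> countable (A `|` B).
Proof.
move=> cA cB.
have -> : A `|` B = \bigcup_(b in [set: bool]) (if b then A else B).
  apply/seteqP; split=> x; first by case; [exists true | exists false].
  by case=> -[] _ ?; [left | right].
by apply: bigcup_countable => // -[].
Qed.

Lemma countable_seq_list (U : eqType) (L : seq U) : countable [set` L].
Proof. exact/finite_set_countable/finite_seq. Qed.

Lemma countable_supp (J : choiceType) (D : set J) :
  countable D -> countable [set s : seq (J * bool) | supp D s].
Proof.
move=> /countable_injP [f finj]; apply/countable_injP.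
exists (fun s => pickle [seq (f p.1, p.2) | p <- s]) => s t.
rewrite !inE /= => Ds Dt /(pcan_inj pickleK).
elim: s t Ds Dt => [|[i a] s ih] [|[j b] t] //= /andP[/asboolP Di Ds] /andP[/asboolP Dj Dt] [ij -> st].
by congr ((_, _) :: _); [apply: finj; rewrite ?inE|apply: ih].
Qed.

Section Codes.
Variable J : choiceType.
Implicit Types (s : seq (J * bool)) (u v : J -> bool) (C : set (J -> bool)).

(** A code lists countably many cylinders; [Dset c] is the closed set left
    after deleting them.  These are exactly the closed sets depending on
    countably many coordinates, and there are only continuum many codes when
    [J] has at most continuum many elements. *)
Definition code := nat -> option (seq (J * bool)).

Definition Dset (c : code) : set (J -> bool) :=
  [set u | forall n s, c n = Some s -> ~ cyl s u].

Definition csupp (D : set J) (c : code) := forall n s, c n = Some s -> supp D s.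

Lemma Dset_closed c : cylclosed (Dset c).
Proof.
move=> u /existsNP [n] /existsNP [s] /not_implyP [cs /contrapT su].
by exists s => // v sv /(_ n s cs).
Qed.

Lemma Dset_agree D c u v : csupp D c -> agree D u v -> Dset c u -> Dset c v.
Proof.
move=> Dc uv cu n s cs sv; apply: (cu n s cs).
by apply: cyl_agree sv; [exact: Dc cs|exact: agree_sym].
Qed.

Lemma code_of (D : set J) (S : set (seq (J * bool))) : countable S ->
  (forall s, S s -> supp D s) -> exists2 c, csupp D c & Dset c = ~` cyls S.
Proof.
move=> /countable_enum [c cP] SD; exists c.
  by move=> n s cs; apply: SD; apply/cP; exists n.
apply/seteqP; split=> u.
  by move=> cu [s /cP [n cs]] su; exact: cu cs su.
by move=> nu n s cs su; apply: nu; exists s => //; apply/cP; exists n.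
Qed.

(** The points of [U] fall into compact fibres over the second countable cube
    [2^D], and each fibre has a neighbourhood determined by finitely many
    coordinates in [D] that is finitely covered. *)
Lemma saturated_lindelof (D : set J) (U : set (J -> bool)) S : countable D ->
  (forall u v, agree D u v -> U u -> U v) -> U `<=` cyls S ->
  exists S', [/\ S' `<=` S, countable S' & U `<=` cyls S'].
Proof.
move=> cD satU US.
pose P s (L : seq (seq (J * bool))) :=
  {subset L <= (fun t => `[< S t >])} /\ cyl s `<=` cyls [set` L].
pose Q s := supp D s /\ exists L, P s L.
have /choice [L LP] : forall s, exists L, Q s -> P s L.
  by move=> s; have [[_ [L PL]]|] := pselect (Q s); [exists L | exists [::]].
exists (\bigcup_(s in Q) [set` L s]); split.
- move=> t [s Qs tL]; have [/(_ t tL) + _] := LP s Qs.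
  by rewrite unfold_in => /asboolP.
- apply: bigcup_countable => [|s _]; last exact: countable_seq_list.
  by apply: sub_countable (countable_supp cD); apply: subset_card_le => s [].
move=> u Uu; have [|s [Ds su [K KS sK]]] := @agree_cover _ D u S.
  by move=> v uv; apply: US; exact: satU Uu.
have Qs : Q s.
  by split=> //; exists K; split=> // t tK; rewrite unfold_in; apply/asboolP/KS.
have [_ /(_ u su) [t tL tu]] := LP s Qs.
by exists t => //; exists s.
Qed.

(** The sets depending on the coordinates in [D] only are the fixed points of
    [sat D]; [sat D C] is the preimage of the projection of [C] to [2^D]. *)
Definition sat (D : set J) C : set (J -> bool) :=
  [set u | exists2 v, C v & agree D u v].

Lemma sat_agree D C u v : agree D u v -> sat D C u -> sat D C v.
Proof.
move=> uv [w Cw uw]; exists w => //.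
by apply: agree_trans uw; exact: agree_sym.
Qed.

Lemma sub_sat D C : C `<=` sat D C.
Proof. by move=> u Cu; exists u. Qed.

Lemma sat_sub D D' C : D `<=` D' -> sat D' C `<=` sat D C.
Proof. by move=> DD u [v Cv uv]; exists v => //; exact: agree_sub uv. Qed.

(** The projection of a compact set is closed. *)
Lemma sat_code D C : countable D -> cylclosed C ->
  exists2 c, csupp D c & Dset c = sat D C.
Proof.
move=> cD cC; have [||c cs e] := @code_of D [set s | supp D s /\ cyl s `<=` ~` C].
- by apply: sub_countable (countable_supp cD); apply: subset_card_le => s [].
- by move=> s [].
exists c => //; rewrite e; apply/seteqP; split=> u.
  move=> nu; apply: cyl_fip => // s Ds su; apply: contrapT => ne.
  by apply: nu; exists s => //; split=> // v sv Cv; apply: ne; exists v.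
move=> [v Cv uv] [s [Ds sC] su].
have := sC v; apply => //.
exact: cyl_agree Ds uv su.
Qed.

Definition cmeet (f : nat -> code) : code :=
  fun n => if unpickle n is Some (k, l) then f k l else None.

Lemma cmeetE f : Dset (cmeet f) = \bigcap_k Dset (f k).
Proof.
apply/seteqP; split=> u; rewrite /Dset /cmeet /=.
  by move=> h k _ n s fs; apply: (h (pickle (k, n))); rewrite pickleK.
move=> h n s; case: unpickle => // -[k l] e; exact: h e.
Qed.

(** The points of a nonempty closed set [C] cannot all be caught by countably
    many coded sets each of which is nowhere dense in [C]: a descending
    sequence of cylinders avoids them one after the other. *)
Lemma baire C D (Q : set code) : cylclosed C -> C !=set0 -> countable Q ->
  (forall c s, Q c -> supp D s -> C `&` cyl s !=set0 ->
    exists t, [/\ supp D t, C `&` cyl (s ++ t) !=set0 & cyl t `<=` ~` Dset c]) ->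
  exists2 u, C u & forall c, Q c -> ~ Dset c u.
Proof.
move=> cC [u0 Cu0] /countable_enum [q qP] step.
pose ok s := supp D s /\ C `&` cyl s !=set0.
have /choice [nx nxP] : forall x : nat * seq (J * bool), exists t : seq (J * bool),
    ok x.2 -> ok (x.2 ++ t) /\ (forall c, q x.1 = Some c -> cyl t `<=` ~` Dset c).
  move=> [n s] /=; have [oks|] := pselect (ok s); last by exists [::].
  case e : (q n) => [c|]; last by exists [::] => /= _; rewrite cats0; split.
  have [|t [Dt Ct tc]] := step c s _ oks.1 oks.2; first by apply/qP; exists n.
  exists t => _; split; first by split=> //; apply: supp_cat => //; exact: oks.1.
  by move=> c' [<-].
pose fix o n := if n is m.+1 then o m ++ nx (m, o m) else [::].
have oko n : ok (o n).
  by elim: n => [|n /(nxP (n, o n)) []] //=; split => //; exists u0.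
(* If no point of C lay in all the cylinders chosen, the flipped single
   conditions would cover C, hence so would finitely many of them. *)
pose S := [set s : seq (J * bool) | exists n p, p \in o n /\ s = [:: (p.1, ~~ p.2)]].
have [CS|/existsNP [u /not_implyP[Cu nu]]] := pselect (C `<=` cyls S).
  have [L LS LC] := cyl_compact cC CS.
  have [N NP] : exists N, forall s, s \in L ->
      exists p, p \in o N /\ s = [:: (p.1, ~~ p.2)].
    elim: L LS {LC} => [|s L ih] LS; first by exists 0%N.
    have [|N NP] := ih; first by move=> t tL; apply: LS; rewrite inE tL orbT.
    have [n [p [pn e]]] := LS s (mem_head _ _).
    have sub k l : (k <= l)%N -> {subset o k <= o l}.
      elim: l => [|l il]; first by rewrite leqn0 => /eqP ->.
      rewrite leq_eqVlt => /orP[/eqP ->//|]; rewrite ltnS => /il h x /h /=.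
      by rewrite mem_cat => ->.
    exists (maxn n N) => t; rewrite inE => /orP[/eqP ->|/NP [r [rN ->]]].
      by exists p; split=> //; apply: sub pn; exact: leq_maxl.
    by exists r; split=> //; apply: sub rN; exact: leq_maxr.
  have [_ [u [Cu ou]]] := oko N; have [s sL su] := LC u Cu.
  have [p [pN e]] := NP s sL; move: ou su; rewrite e /cyl /= andbT => /allP /(_ p pN) /eqP ->.
  by case: p.2.
have ou n : cyl (o n) u.
  rewrite /cyl /=; apply/allP => p pn; apply/eqP; apply: contrapT => up; apply: nu.
  exists [:: (p.1, ~~ p.2)]; first by exists n, p.
  by rewrite /cyl /= andbT; case: (u p.1) p.2 up => [] [].
exists u => // c /qP [n qn]; have [_] := nxP (n, o n) (oko n).
by move=> /(_ c qn); apply; have := ou n.+1; rewrite /= cyl_cat => -[].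
Qed.

End Codes.

(** * Lindelof sets of covers *)

Definition cube_lindelof (J : choiceType) (Y : set (J -> bool)) :=
  forall S, Y `<=` cyls S ->
    exists S', [/\ S' `<=` S, countable S' & Y `<=` cyls S'].

Section CubeSubspace.
Variables (J : choiceType) (Y : set (J -> bool)).

(** The subspace [Y] of the cube, with the traces of cylinders as a base. *)
Definition cubesub := {y : J -> bool | Y y}.

Definition cubesub_open : set_system cubesub :=
  [set A | forall y, A y ->
    exists2 s, cyl s (sval y) & forall z, cyl s (sval z) -> A z].

Lemma cubesub_openT : cubesub_open setT.
Proof. by move=> y _; exists [::]. Qed.

Lemma cubesub_openI : setI_closed cubesub_open.
Proof.
move=> A A' oA oA' y [/oA [s sy sA] /oA' [t ty tA]]; exists (s ++ t).
  by rewrite cyl_cat.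
by move=> z; rewrite cyl_cat => -[/sA ? /tA].
Qed.

Lemma cubesub_open_bigU (I : Type) (f : I -> set cubesub) :
  (forall i, cubesub_open (f i)) -> cubesub_open (\bigcup_i f i).
Proof.
move=> of_ y [i _ /of_ [s sy sA]]; exists s => // z /sA ?.
by exists i.
Qed.

HB.instance Definition _ := gen_eqMixin cubesub.
HB.instance Definition _ := gen_choiceMixin cubesub.
HB.instance Definition _ := isOpenTopological.Build cubesub
  cubesub_openT cubesub_openI cubesub_open_bigU.

Lemma cubesub_openE (A : set cubesub) : open A = cubesub_open A.
Proof. by []. Qed.

Lemma cubesub_cyl_open s : open [set y : cubesub | cyl s (sval y)].
Proof. by rewrite cubesub_openE; move=> y sy; exists s. Qed.

Lemma cubesub_cyl_closed s : closed [set y : cubesub | cyl s (sval y)].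
Proof.
rewrite -[X in closed X]setCK; apply: open_closedC.
rewrite cubesub_openE => y /= ns.
exists (gcyl (sval y) (unzip1 s)); first exact/gcylE.
move=> z /gcylE zy; apply: contra_not ns; rewrite /cyl /= => /allP sz.
by apply/allP => p ps; rewrite -zy ?sz//; apply/mapP; exists p.
Qed.

(** [Y] is regular because the traces of cylinders are clopen. *)
Lemma cubesub_lindelof : cube_lindelof Y -> lindelof cubesub.
Proof.
move=> YL; split.
- move=> x y /eqP xy.
  have [i xyi] : exists i, sval x i <> sval y i.
    apply/existsNP => e; apply: xy; case: x y e => [x Yx] [y Yy] /= /funext e.
    by rewrite e in Yx *; congr exist; exact: Prop_irrelevance.
  exists [set z : cubesub | cyl [:: (i, sval x i)] (sval z)]; split.
  + exact: cubesub_cyl_open.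
  + by rewrite inE /cyl /= eqxx.
  + by rewrite inE /cyl /= andbT => /eqP e; apply: xyi.
- move=> a U aU.
  have [A [oA Aa] AU] : exists2 A, open_nbhs a A & A `<=` U by rewrite nbhsE in aU.
  move: oA; rewrite cubesub_openE => /(_ a Aa) [s sa sA].
  exists [set z : cubesub | cyl s (sval z)].
    by apply: open_nbhs_nbhs; split => //; exact: cubesub_cyl_open.
  rewrite -(closure_id _).1; last exact: cubesub_cyl_closed.
  by move=> z /sA /AU.
move=> C [Co Ccov].
pose P s U := C U /\ forall z : cubesub, cyl s (sval z) -> U z.
have [|S' [S'S cS' YS']] := YL [set s | exists U, P s U].
  move=> y Yy; have : setT (exist _ y Yy : cubesub) by [].
  rewrite -Ccov => -[U CU Uy]; have := Co U CU; rewrite cubesub_openE => /(_ _ Uy) [s sy sU].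
  by exists s => //; exists U.
have /choice [f fP] : forall s, exists U, S' s -> P s U.
  by move=> s; have [/S'S [U PU]|] := pselect (S' s); [exists U | exists setT].
exists (f @` S'); split.
- by move=> _ [s S's <-]; exact: (fP s S's).1.
- exact: countable_imageT.
apply/seteqP; split=> // y _; have [s S's sy] := YS' _ (svalP y).
by exists (f s); [exists s | apply: (fP s S's).2].
Qed.

End CubeSubspace.

(** Mapping [x] to the set of indices of the members of [B] that miss it sends
    [F] into this set, which consists of all subsets of the images.  Passing to
    subsets makes it the image of a closed set of pairs, so that it behaves well
    even when [X] has no separation property. *)
Definition missed (X J : Type) (F : set X) (B : J -> set X) : set (J -> bool) :=
  [set t | exists2 x, F x & forall i, t i -> ~ B i x].

Lemma open_rectangle (X Y : topologicalType) (A : set X) (A' : set Y) :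
  open A -> open A' -> open (A `*` A').
Proof.
move=> oA oA'.
have -> : A `*` A' = fst @^-1` A `&` snd @^-1` A' by [].
apply: openI.
  by apply: open_comp => // x _; exact: cvg_fst.
by apply: open_comp => // x _; exact: cvg_snd.
Qed.

(** A Lindelof set of covers of [F] by members of [B] is, uniformly, a set of
    covers by countably many fixed members: this is the Lindelof property of
    the product of [X] with that set of covers. *)
Lemma separation (X : topologicalType) (J : choiceType) (F : set X)
    (B : J -> set X) (Y : set (J -> bool)) :
  productively_quasi_lindelof X -> closed F -> (forall i, open (B i)) ->
  cube_lindelof Y -> (forall y, Y y -> ~ missed F B y) ->
  exists2 D : set J, countable D &
    forall y t, Y y -> missed F B t -> ~ agree D y t.
Proof.
move=> hX cF oB YL Ynm.
have qL := hX _ (cubesub_lindelof YL).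
(* A cover y of F contains, for each x in F, an index i with x in B i, and
   the condition on y that i belongs to it is open. *)
pose A i : set (X * cubesub Y) := B i `*` [set y | cyl [:: (i, true)] (sval y)].
pose A' : set (X * cubesub Y) := (~` F) `*` setT.
have [|C' [C'C cC' C'cov]] := qL [set U | U = A' \/ exists i, U = A i].
  split.
    move=> U [->|[i ->]].
      by apply: open_rectangle; [exact: closed_openC | exact: openT].
    by apply: open_rectangle => //; exact: cubesub_cyl_open.
  apply/seteqP; split=> // -[x y] _.
  have [Fx|nFx] := pselect (F x); last by exists A' => //; left.
  have : ~ missed F B (sval y) by apply: Ynm; exact: svalP.
  move=> /forall2NP /(_ x) [//|/existsNP [i /not_implyP [yi /contrapT Bi]]].
  by exists (A i); [right; exists i | split=> //=; rewrite /cyl /= yi].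
have /choice [f fP] : forall U, exists i : option J, (exists i, U = A i) -> exists2 j, i = Some j & U = A j.
  move=> U; have [[i e]|] := pselect (exists i, U = A i); last by exists None.
  by exists (Some i) => _; exists i.
exists [set i | exists2 U, C' U & f U = Some i].
  apply: (@countable_inj_on _ _ (@Some J) _ (f @` C')).
  - exact: countable_imageT.
  - by move=> i [U C'U e]; exists U.
  - by move=> i j _ _ [].
move=> y t Yy [x Fx tx] yt.
have : setT (x, exist _ y Yy : cubesub Y) by [].
rewrite -C'cov => -[U C'U Uxy]; have [e|ei] := C'C U C'U.
  by move: Uxy; rewrite e => -[].
have [i fU e] := fP U ei; move: Uxy; rewrite e => -[/= Bi].
rewrite /cyl /= andbT => /eqP yi; apply: (tx i) Bi.
by rewrite -yt //; exists U.
Qed.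

(** * The first uncountable ordinal *)

Section Omega1.
Variables (T : choiceType) (R : rel T).
Hypothesis omega1R : is_omega1 R.

Definition below (x : T) : set T := [set y | R y x /\ y <> x].

Lemma wo_min (A : set T) : A !=set0 -> exists2 m, A m & forall y, A y -> R m y.
Proof.
case: omega1R => wo _ _ [a Aa].
have [|m [[Am mA] _]] := wo (fun x => `[< A x >]).
  by exists a; rewrite unfold_in; apply/asboolP.
exists m; first by move: Am; rewrite unfold_in => /asboolP.
by move=> y Ay; apply: mA; rewrite unfold_in; apply/asboolP.
Qed.

Lemma wo_total x y : R x y \/ R y x.
Proof.
have [|m [->|->] h] := @wo_min [set z | z = x \/ z = y]; first by exists x; left.
  by left; apply: h; right.
by right; apply: h; left.
Qed.

Lemma wo_anti x y : R x y -> R y x -> x = y.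
Proof.
move=> xy yx; case: omega1R => wo _ _.
have rf z : R z z by have [] := wo_total z z.
have [|m [_ mu]] := wo (fun z => (z == x) || (z == y)).
  by exists x; rewrite unfold_in eqxx.
have -> : y = m.
  apply/esym/mu; split; first by rewrite unfold_in eqxx orbT.
  by move=> z; rewrite unfold_in => /orP[] /eqP ->.
apply/esym/mu; split; first by rewrite unfold_in eqxx.
by move=> z; rewrite unfold_in => /orP[] /eqP ->.
Qed.

Lemma wo_trans x y z : R x y -> R y z -> R x z.
Proof.
move=> xy yz.
have [|m mA h] := @wo_min [set t | [\/ t = x, t = y | t = z]].
  by exists x; constructor 1.
case: mA h => -> h; first by apply: h; rewrite /=; constructor 3.
  by rewrite (@wo_anti x y) //; apply: h; constructor 1.
by rewrite -(@wo_anti y z) //; apply: h; constructor 2.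
Qed.

Lemma below_countable x : countable (below x).
Proof. by case: omega1R => _ _; exact. Qed.

Lemma not_below x y : ~ below x y -> R x y.
Proof.
move=> nb; have [//|yx] := wo_total x y; apply: contrapT => nxy; apply: nb.
by split=> // e; apply: nxy; rewrite e in yx *.
Qed.

Lemma below_le x y : R x y -> below x `<=` below y.
Proof.
move=> xy z [zx nzx]; split; first exact: wo_trans xy.
by move=> e; apply: nzx; apply: wo_anti => //; rewrite e.
Qed.

Lemma below_lt x y : below y x -> below x `<=` below y.
Proof. by move=> [xy _]; exact: below_le. Qed.

Lemma below_bound (A : set T) : countable A -> exists x, A `<=` below x.
Proof.
move=> cA; apply: contrapT => /forallNP nb; case: omega1R => _ + _; apply.
have -> : [set: T] = \bigcup_(y in A) (below y `|` [set y]).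
  apply/seteqP; split=> // x _.
  have /existsNP [y /not_implyP [Ay /not_below xy]] := nb x.
  exists y => //; have [->|nxy] := pselect (x = y); first by right.
  by left.
apply: bigcup_countable => // y _.
apply: countableU; [exact: below_countable | exact: countable1].
Qed.

Lemma omega1_inhabited : exists x : T, True.
Proof. by have [x _] := below_bound (countable0 T); exists x. Qed.

(** There are only countably many arguments of [G] below a countable ordinal;
    iterate. *)
Lemma below_closed (G : seq (T * bool) -> T) :
  exists x, forall s, supp (below x) s -> below x (G s).
Proof.
have /choice [nx nxP] : forall x, exists y, below y x /\
    forall s, supp (below x) s -> below y (G s).
  move=> x; have [|y xy] := @below_bound
      ([set x] `|` G @` [set s | supp (below x) s]).
    apply: countableU; first exact: countable1.
    apply: countable_imageT; exact/countable_supp/below_countable.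
  exists y; split=> [|s sx]; first by apply: xy; left.
  by apply: xy; right; exists s.
have [x0 _] := omega1_inhabited.
pose o n := iter n nx x0.
have mono m n : (m <= n)%N -> below (o m) `<=` below (o n).
  elim: n => [|n ih]; first by rewrite leqn0 => /eqP ->.
  rewrite leq_eqVlt => /orP[/eqP ->//|]; rewrite ltnS => /ih mn y /mn.
  by apply: below_lt; exact: (nxP (o n)).1.
pose D := \bigcup_n below (o n).
(* The closure of x0 under G is a countable initial segment, so it lies
   below the least element of its complement. *)
have [|m mD mmin] := @wo_min (~` D).
  apply: contrapT => nD; case: omega1R => _ + _; apply.
  have -> : [set: T] = D.
    by apply/seteqP; split=> // x _; apply: contrapT => nx'; apply: nD; exists x.
  by apply: bigcup_countable => // n _; exact: below_countable.
have bD : below m = D.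
  apply/seteqP; split=> y.
    move=> [ym nym]; apply: contrapT => /mmin my; apply: nym; exact: wo_anti.
  move=> [n _ yn]; apply: contrapT => /not_below my; apply: mD; exists n => //.
  have [e|nym] := pselect (m = y); first by rewrite e.
  by apply: below_lt yn _ _.
exists m; rewrite bD => s sD.
have [k sk] : exists k, supp (below (o k)) s.
  elim: s sD => [|p s ih] /=; first by exists 0%N.
  case/andP=> /asboolP [i _ pi] /ih [k sk]; exists (maxn i k); apply/andP; split.
    by apply/asboolP; apply: mono pi; exact: leq_maxl.
  by apply: supp_sub sk; apply: mono; exact: leq_maxr.
by exists k.+1 => //; exact: (nxP (o k)).2.
Qed.

Lemma below_supp (c : code T) : exists x, csupp (below x) c.
Proof.
have [|x xc] := @below_bound (\bigcup_n [set` unzip1 (odflt [::] (c n))]).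
  by apply: bigcup_countable => // n _; exact: countable_seq_list.
exists x => n s cs; apply/allP => p ps; apply/asboolP/xc.
by exists n => //=; rewrite cs /=; apply/mapP; exists p.
Qed.

End Omega1.

(** * Sigma-compactness of the countable levels *)

Section Glue.
Variables T T' : choiceType.

Definition glue (z : T -> bool) (k : T' -> bool) : T + T' -> bool :=
  fun j => match j with inl i => z i | inr i => k i end.

Fixpoint lpart (s : seq ((T + T') * bool)) : seq (T * bool) :=
  match s with
  | [::] => [::]
  | (inl i, b) :: s' => (i, b) :: lpart s'
  | _ :: s' => lpart s'
  end.

Fixpoint rpart (s : seq ((T + T') * bool)) : seq (T' * bool) :=
  match s with
  | [::] => [::]
  | (inr i, b) :: s' => (i, b) :: rpart s'
  | _ :: s' => rpart s'
  end.

Lemma cyl_glue s z k : cyl s (glue z k) <-> cyl (lpart s) z /\ cyl (rpart s) k.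
Proof.
elim: s => [|[[i|i] b] s ih] //=.
  rewrite /cyl /=; split; first by move=> /andP[-> /ih].
  by move=> [/andP[-> a] b0] /=; exact: (ih.2 (conj a b0)).
rewrite /cyl /=; split; first by move=> /andP[-> /ih].
by move=> [a /andP[-> b0]] /=; exact: (ih.2 (conj a b0)).
Qed.

Lemma supp_lpart (D : set T) s :
  supp [set j | if j is inl i then D i else True] s -> supp D (lpart s).
Proof.
elim: s => [|[[i|i] b] s ih] //=; last by move=> /andP[_ /ih].
by move=> /andP[Di /ih Ds]; apply/andP; split=> //; apply/asboolP; move/asboolP: Di.
Qed.

End Glue.

Section Levels.
Variables (T : choiceType) (R : rel T).
Hypothesis omega1R : is_omega1 R.
Variable en : T -> code T.
Hypothesis en_surj : forall c, exists b, en b = c.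
Variables (X : topologicalType) (F : set X) (B : T -> set X).
Hypothesis hX : productively_quasi_lindelof X.
Hypothesis closedF : closed F.
Hypothesis openB : forall i, open (B i).

Local Notation below := (below R).
Local Notation V := (missed F B).

(** Otherwise choose by induction points [w b] of [V] avoiding the first [b]
    closed subsets of the saturation. Tagged with isolated labels and added
    to the complement of the saturation they form a Lindelof set, because
    every neighbourhood of that complement contains the complement of one of
    those closed subsets; and no countable set of coordinates separates the
    labelled points from [V]. *)
Lemma sat_sigma_compact x : exists Q : set (code T),
  [/\ countable Q, forall c, Q c -> csupp (below x) c
    & sat (below x) V = \bigcup_(c in Q) Dset c].
Proof.
pose U := sat (below x) V.
pose ok c := csupp (below x) c /\ Dset c `<=` U.
apply: contrapT => nQ.
have nV (Q : set (code T)) : countable Q -> (forall c, Q c -> ok c) ->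
    exists2 v, V v & forall c, Q c -> ~ Dset c v.
  move=> cQ Qok; apply: contrapT => nv; apply: nQ; exists Q; split=> //.
    by move=> c /Qok [].
  apply/seteqP; split=> [u [v Vv uv]|u [c Qc cu]]; last exact: (Qok c Qc).2.
  apply: contrapT => nu; apply: nv; exists v => // c Qc cv; apply: nu.
  by exists c => //; apply: Dset_agree cv; [exact: (Qok c Qc).1 | exact: agree_sym].
have /choice [w wP] : forall b, exists v, V v /\
    forall g, R g b -> ok (en g) -> ~ Dset (en g) v.
  move=> b.
  have [||v Vv vP] := nV [set c | ok c /\ exists2 g, R g b & en g = c].
  - apply: (@sub_countable _ _ _ (en @` (below b `|` [set b]))).
      apply: subset_card_le => c [_ [g gb e]]; exists g => //.
      by have [->|] := pselect (g = b); [right | left].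
    apply: countable_imageT; apply: countableU; [exact: below_countable|exact: countable1].
  - by move=> c [].
  by exists v; split=> // g gb okg; apply: vP; split=> //; exists g.
pose zero : T -> bool := fun=> false.
pose pt b := glue (w b) (pred1 b).
pose Y := [set y | (exists2 z, ~ U z & y = glue z zero) \/ exists b, y = pt b].
pose B' (j : T + T) := match j with inl i => B i | inr _ => setT end.
have oB' j : open (B' j) by case: j => i //=; exact: openT.
have Ynm y : Y y -> ~ missed F B' y.
  case=> [[z nUz ->]|[b ->]] [t Ft ht]; last by have := ht (inr b); rewrite /= eqxx; exact.
  by apply: nUz; apply: sub_sat; exists t => // i; exact: (ht (inl i)).
have YL : cube_lindelof Y.
  move=> S YS.
  (* Around each point outside U some cylinder is covered by finitely many
     members of S; keep one cylinder for each possible left part l. *)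
  pose P l (sL : seq ((T + T) * bool) * seq (seq ((T + T) * bool))) :=
    [/\ lpart sL.1 = l, cyl (rpart sL.1) zero, {subset sL.2 <= (fun t => `[< S t >])}
      & cyl sL.1 `<=` cyls [set` sL.2]].
  pose Q l := supp (below x) l /\ exists sL, P l sL.
  have cQ : countable Q.
    apply: sub_countable (countable_supp (below_countable omega1R x)).
    by apply: subset_card_le => l [].
  have [|c cs cE] := @code_of _ (below x) Q cQ; first by move=> l [].
  have okc : ok c.
    split=> //; rewrite cE => z; apply: contra_notP => nUz.
    have [|s [Ds sz [L LS sL]]] := @agree_cover _
        [set j | if j is inl i then below x i else True] (glue z zero) S.
      move=> v zv; apply: YS; left; exists (fun i => v (inl i)).
        by apply: contra_not nUz; apply: sat_agree => i xi; rewrite -(zv (inl i)).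
      by apply/funext => -[i|i] //=; rewrite -(zv (inr i)).
    have [sz1 sz2] := (cyl_glue _ _ _).1 sz.
    exists (lpart s) => //; split; first exact: supp_lpart.
    by exists (s, L); split=> // t tL; rewrite unfold_in; apply/asboolP/LS.
  have [g eg] := en_surj c.
  have /choice [sL sLP] : forall l, exists sL, Q l -> P l sL.
    by move=> l; have [[_ [sL PsL]]|] := pselect (Q l); [exists sL | exists ([::], [::])].
  have /choice [t tP] : forall b, exists s, S s /\ cyl s (pt b).
    by move=> b; have [|s Ss sb] := YS (pt b); [right; exists b | exists s].
  (* Labelled points of index beyond g avoid Dset c, so they lie in one of
     the chosen cylinders unless their own label is mentioned there. *)
  pose E := (below g `|` [set g]) `|`
    \bigcup_(l in Q) [set` unzip1 (rpart (sL l).1)].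
  exists ((\bigcup_(l in Q) [set` (sL l).2]) `|` t @` E); split.
  - move=> s [[l Ql sl]|[b _ <-]]; last exact: (tP b).1.
    by have [_ _ /(_ s sl) + _] := sLP l Ql; rewrite unfold_in => /asboolP.
  - apply: countableU.
      by apply: bigcup_countable => // l _; exact: countable_seq_list.
    apply: countable_imageT; apply: countableU; last first.
      by apply: bigcup_countable => // l _; exact: countable_seq_list.
    by apply: countableU; [exact: below_countable|exact: countable1].
  have cov l y : Q l -> cyl (sL l).1 y ->
      cyls ((\bigcup_(l in Q) [set` (sL l).2]) `|` t @` E) y.
    move=> Ql ly; have [_ _ _ /(_ y ly) [s sl sy]] := sLP l Ql.
    by exists s => //; left; exists l.
  move=> y [[z nUz ->]|[b ->]].
    have /contrapT [l Ql lz] : ~ ~ cyls Q z.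
      by have := okc.2; rewrite cE => cU /cU.
    apply: (cov l) => //; have [le re _ _] := sLP l Ql.
    by apply/cyl_glue; rewrite le.
  have [Eb|nEb] := pselect (E b).
    by exists (t b); [right; exists b | exact: (tP b).2].
  have gb : R g b by apply: not_below => // bg; apply: nEb; left; left.
  have := (wP b).2 g gb; rewrite eg => /(_ okc); rewrite cE => /contrapT [l Ql lw].
  apply: (cov l) => //; have [le re _ _] := sLP l Ql.
  apply/cyl_glue; rewrite le; split=> //; apply/allP => p pr.
  have /allP /(_ p pr) /eqP <- := re; rewrite /=; apply/eqP/eqP => e.
  by apply: nEb; right; exists l => //=; apply/mapP; exists p.
have [D cD sepD] := separation hX closedF oB' YL Ynm.
have [b Db] : exists b, [set i | D (inr i)] `<=` below b.
  apply: below_bound => //; apply: (countable_inj_on (f := inr) cD) => //.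
  by move=> i j _ _ [].
apply: (sepD (pt b) (glue (w b) zero)); first by right; exists b.
  have [x0 Fx0 x0P] := (wP b).1.
  by exists x0 => // -[i|i] //=; exact: x0P.
move=> [i|i] //= /Db ib; apply/eqP => e; case: ib; rewrite e.
by [].
Qed.

End Levels.

(** * The theorem of Alster *)

Section Alster.
Variables (T : choiceType) (R : rel T).
Hypothesis omega1R : is_omega1 R.
Variable en : T -> code T.
Hypothesis en_surj : forall c, exists b, en b = c.
Variables (X : topologicalType) (F : set X) (B : T -> set X).
Hypothesis hX : productively_quasi_lindelof X.
Hypothesis closedF : closed F.
Hypothesis openB : forall i, open (B i).

Local Notation below := (below R).
Local Notation V := (missed F B).

(** A point outside [V] is a cover of [F], and a countable subcover shows at a
    countable stage that it lies outside. *)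
Lemma missed_sat u : (forall x, sat (below x) V u) -> V u.
Proof.
move=> satu; apply: contrapT => nVu.
have [|y -> //|D cD sepD] := separation (Y := [set u]) hX closedF openB.
  move=> S uS; have [s Ss su] := uS u erefl.
  exists [set s]; split=> [t -> //||v ->]; first exact: countable1.
  by exists s.
have [x Dx] := below_bound omega1R cD; have [v Vv uv] := satu x.
by apply: (sepD u v) => //; exact: agree_sub uv.
Qed.

(** The cover in the theorem of Alster is encoded by the sigma-ideal of the sets
    contained in the union of countably many of its members. *)
Variable Sm : set (T -> bool) -> Prop.
Hypothesis Sm_sub : forall A A', A `<=` A' -> Sm A' -> Sm A.
Hypothesis Sm_bigcup : forall A : nat -> set (T -> bool),
  (forall n, Sm (A n)) -> Sm (\bigcup_n A n).
Hypothesis Sm_closed : forall C, cylclosed C -> C `<=` V ->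
  exists2 c, C `<=` Dset c & Sm (V `&` Dset c).

Let small c := Sm (V `&` Dset c).

(** The union of the first [x] small coded sets, those not determined below
    [x] being skipped so that the union depends on the coordinates below [x]. *)
Let caught x : set (T -> bool) := [set u | exists b,
  [/\ below x b, csupp (below x) (en b), small (en b) & Dset (en b) u]].

(** Points separated from [V] at a countable stage before any small set that
    contains them has been listed. *)
Let escapes : set (T -> bool) := [set u | exists x, ~ sat (below x) V u /\ ~ caught x u].

Lemma caught_mono x y : R x y -> caught x `<=` caught y.
Proof.
move=> /(below_le omega1R) xy u [b [bx cx sb bu]]; exists b; split=> //.
  exact: xy.
by move=> n s cs; apply: supp_sub (cx n s cs).
Qed.

Lemma caught_agree x u v : agree (below x) u v -> caught x u -> caught x v.
Proof.
move=> uv [b [bx cx sb bu]]; exists b; split=> //.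
exact: Dset_agree cx uv bu.
Qed.

Lemma le_bound (f : nat -> T) : exists x, forall n, R (f n) x.
Proof.
have [|x xf] := @below_bound _ _ omega1R (range f); first exact: countable_imageT.
by exists x => n; have [] : below x (f n) by apply: xf; exists n.
Qed.

Lemma small_caught c : small c -> exists x, Dset c `<=` caught x.
Proof.
move=> sc; have [b eb] := en_surj c; have [x xc] := below_supp omega1R c.
have [|y] := @below_bound _ _ omega1R ([set b] `|` [set x]).
  by apply: countableU; exact: countable1.
move=> xy; exists y => u cu; exists b; rewrite eb; split=> //.
  by apply: xy; left.
have /(below_lt omega1R) sxy : below y x by apply: xy; right.
by move=> n s cs; apply: supp_sub (xc n s cs).
Qed.

(** Let [K] be what remains of [C] when all relatively open pieces contained
    in some [caught x] are deleted, and suppose that it is nonempty.  No small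
    coded set contains a relatively open piece of [K]: the rest of that piece
    would be a countable union of compact sets, each of them caught.  Neither
    does [V], as such a piece would be a closed subset of [V], hence contained
    in a small coded set.  A countable ordinal [x] closed under witnesses for
    the second fact sees every basic piece determined below [x] leave
    [sat (below x) V].  But no point of [C] escapes, so [K] is contained in
    the union of [sat (below x) V] and [caught x]; by sigma-compactness of the
    former this is a countable union of closed sets determined below [x] and
    nowhere dense in [K], against the Baire category theorem. *)
Lemma closed_caught C : cylclosed C -> (forall u, C u -> ~ escapes u) ->
  exists x, C `<=` caught x.
Proof.
move=> cC CY.
pose negl := [set s | exists x, C `&` cyl s `<=` caught x].
pose K := C `&` ~` cyls negl.
have cK : cylclosed K by apply: cylclosedI => //; exact: cylclosed_setCcyls.
have KP C' : cylclosed C' -> C' `<=` C -> (forall u, C' u -> ~ K u) ->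
    exists x, C' `<=` caught x.
  move=> cC' C'C C'K; have [|L LS LC] := @cyl_compact _ _ cC' negl.
    by move=> u C'u; apply: contrapT => nu; apply: (C'K u) => //; split=> //; exact: C'C.
  have [x xL] : exists x, forall s, s \in L -> C `&` cyl s `<=` caught x.
    elim: L LS {LC} => [|s L ih] LS.
      by have [x _] := omega1_inhabited omega1R; exists x.
    have [|x xL] := ih; first by move=> t tL; apply: LS; rewrite inE tL orbT.
    have [y ys] := LS s (mem_head _ _).
    have [xy|yx] := wo_total omega1R x y.
      exists y => t; rewrite inE => /orP[/eqP -> //|tL].
      by apply: subset_trans (caught_mono xy); exact: xL.
    exists x => t; rewrite inE => /orP[/eqP ->|/xL //].
    by apply: subset_trans (caught_mono yx).
  by exists x => u C'u; have [s sL su] := LC u C'u; apply: (xL s sL); split=> //; exact: C'C.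
have [K0|[w Kw]] : K = set0 \/ K !=set0.
  by have [->|/set0P] := eqVneq K set0; [left | right].
  by apply: KP => // u _; rewrite K0.
exfalso.
have not_small_piece c s : small c -> K `&` cyl s !=set0 ->
    exists2 u, (K `&` cyl s) u & ~ Dset c u.
  move=> sc [u [Ku su]]; apply: contrapT => /forall2NP nex.
  have KD v : K v -> cyl s v -> Dset c v.
    by move=> Kv sv; have [] := nex v; [case | exact: contrapT].
  have [x0 x0c] := small_caught sc.
  have /choice [f fP] : forall n, exists x, forall t, c n = Some t ->
      C `&` cyl s `&` cyl t `<=` caught x.
    move=> n; case e : (c n) => [t|]; last by exists x0.
    have [|||x xP] := KP (C `&` cyl s `&` cyl t).
    - by apply: cylclosedI; [apply: cylclosedI => //|]; exact: cylclosed_cyl.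
    - by move=> v [[]].
    - by move=> v [[_ sv] tv] Kv; exact: (KD v Kv sv n t e).
    by exists x => _ [<-].
  have [y yf] := le_bound (fun n => if n is m.+1 then f m else x0).
  case: Ku => _; apply; exists s => //; exists y => v [Cv sv].
  have [/x0c cv|/existsNP [n /existsNP [t /not_implyP [e /contrapT tv]]]] := pselect (Dset c v).
    exact: (caught_mono (yf 0%N)).
  by apply: (caught_mono (yf n.+1)); apply: (fP n t e).
have not_level_piece s : exists x, K `&` cyl s !=set0 ->
    exists2 u, (K `&` cyl s) u & ~ sat (below x) V u.
  apply: contrapT => /forallNP nex.
  have [o _] := omega1_inhabited omega1R.
  have ne : K `&` cyl s !=set0 by have /not_implyP [] := nex o.
  have [||c cP sc] := @Sm_closed (K `&` cyl s).
  - by apply: cylclosedI => //; exact: cylclosed_cyl.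
  - move=> u Ksu; apply: missed_sat => x; apply: contrapT => nu.
    by apply: (nex x) => _; exists u.
  by have [u /cP] := not_small_piece c s sc ne.
have [G GP] := choice not_level_piece.
have [x xG] := below_closed omega1R G.
have [Q0 [cQ0 Q0x Q0E]] := sat_sigma_compact omega1R en_surj hX closedF openB x.
pose Q1 := [set c | exists b, [/\ below x b, csupp (below x) (en b), small (en b) & en b = c]].
have [|||u Ku uQ] := @baire _ K (below x) (Q0 `|` Q1) cK.
- by exists w.
- apply: countableU => //; apply: (@sub_countable _ _ _ (en @` below x)).
    by apply: subset_card_le => c [b [bx _ _ e]]; exists b.
  by apply: countable_imageT; exact: below_countable.
- move=> c s Qc sx ne.
  have [cx [u [Ku su] ncu]] : csupp (below x) c /\ exists2 u, (K `&` cyl s) u & ~ Dset c u.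
    case: Qc => [Q0c|[b [bx cx sb <-]]]; last by split=> //; exact: not_small_piece.
    split; first exact: Q0x.
    have [u Ksu nu] := GP s ne; exists u => //; apply: contra_not nu => cu.
    apply: (sat_sub (below_lt omega1R (xG s sx))).
    by rewrite Q0E; exists c.
  move/existsNP: ncu => [n /existsNP [t /not_implyP [e /contrapT tu]]].
  exists t; split; first exact: cx e.
    by exists u; rewrite cyl_cat.
  by move=> v tv /(_ n t e).
apply: (CY u Ku.1); exists x; split.
  by rewrite Q0E => -[c Q0c]; apply: uQ; left.
by move=> [b [bx cx sb]]; apply: uQ; right; exists b.
Qed.

(** The complement of the union of a cover is a closed set without escaping
    points, so it is caught at some [x]; the points outside [caught x], and
    those that escape at one of the countably many stages before [x], form
    sets depending on countably many coordinates. *)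
Lemma escapes_lindelof : cube_lindelof escapes.
Proof.
move=> S YS.
have [||x xP] := @closed_caught (~` cyls S).
- exact: cylclosed_setCcyls.
- by move=> u nu /YS.
have [|||S0 [S0S cS0 S0P]] := @saturated_lindelof _ (below x) (~` caught x) S.
- exact: below_countable.
- by move=> u v uv; apply: contra_not; apply: caught_agree; exact: agree_sym.
- by move=> u nu; apply: contrapT => /xP.
pose Yx y := [set u | ~ sat (below y) V u /\ ~ caught y u].
have /choice [f fP] : forall y, exists S', [/\ S' `<=` S, countable S' & Yx y `<=` cyls S'].
  move=> y; apply: (@saturated_lindelof _ (below y)).
  - exact: below_countable.
  - move=> u v /agree_sym uv [nu nu']; split.
      by apply: contra_not nu; exact: sat_agree.
    by apply: contra_not nu'; exact: caught_agree.
  - by move=> u nu; apply: YS; exists y.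
exists (S0 `|` \bigcup_(y in below x) f y); split.
- by move=> s [/S0S //|[y _]]; have [+ _ _] := fP y; apply.
- apply: countableU => //; apply: bigcup_countable; first exact: below_countable.
  by move=> y _; have [] := fP y.
move=> u [y [nu nHu]].
have [Hu|/S0P [s S0s su]] := pselect (caught x u); last by exists s => //; left.
have yx : below x y.
  by apply: contrapT => /(not_below omega1R) /caught_mono /(_ u Hu).
have [_ _ /(_ u (conj nu nHu)) [s fs su]] := fP y.
by exists s => //; right; exists y.
Qed.

(** Separate the Lindelof set of escaping points from [V]: for some [x] no
    point of the sigma-compact set [sat (below x) V] escapes, so each of its
    compact pieces is caught, and [V] is covered by countably many small
    sets. *)
Lemma alster : Sm V.
Proof.
have [|D cD sepD] := separation hX closedF openB escapes_lindelof.
  by move=> u [x [nu _]] /(@sub_sat _ (below x)).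
have [x Dx] := below_bound omega1R cD.
have nY u : sat (below x) V u -> ~ escapes u.
  by move=> [v Vv uv] Yu; apply: (sepD u v) => //; exact: agree_sub uv.
have [Q [cQ Qx QE]] := sat_sigma_compact omega1R en_surj hX closedF openB x.
have [q qP] := countable_enum cQ.
have /choice [f fP] : forall n, exists y, forall c, q n = Some c -> Dset c `<=` caught y.
  move=> n; case e : (q n) => [c|]; last by exists x.
  have [||y yP] := @closed_caught (Dset c); first exact: Dset_closed.
    by move=> u cu; apply: nY; rewrite QE; exists c => //; apply/qP; exists n.
  by exists y => _ [<-].
have [y yf] := le_bound f.
have [r rP] := countable_enum (below_countable omega1R y).
pose A n := [set u | V u /\ exists b, [/\ r n = Some b, small (en b) & Dset (en b) u]].
apply: (@Sm_sub _ (\bigcup_n A n)).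
  move=> u Vu; have : sat (below x) V u by exact: sub_sat.
  rewrite QE => -[c /qP [n qn] cu].
  have [b [/rP [m rm] _ sb bu]] : caught y u by apply: (caught_mono (yf n)); exact: (fP n c qn).
  by exists m => //; split=> //; exists b.
apply: Sm_bigcup => n.
have [||c0 _ sc0] := @Sm_closed set0; [|by []|].
  by move=> u _; exists (gcyl u [::]); [exact/gcylE | move=> v _ []].
have [[b [rb sb]]|nb] := pselect (exists b, r n = Some b /\ small (en b)).
  apply: Sm_sub sb => u [Vu [b' [rb' _ bu]]].
  by move: rb'; rewrite rb => -[->].
by apply: Sm_sub sc0 => u [_ [b [rb sb _]]]; case: nb; exists b.
Qed.

End Alster.

(** * Countable powers *)

Section Power.
Variables (T : choiceType) (R : rel T).
Hypothesis omega1R : is_omega1 R.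
Variable en : T -> code T.
Hypothesis en_surj : forall c, exists b, en b = c.
Variables (X : topologicalType) (F : set X) (B : T -> set X).
Hypothesis hX : productively_quasi_lindelof X.
Hypothesis closedF : closed F.
Hypothesis openB : forall i, open (B i).

Local Notation V := (missed F B).

(** Basic open sets of the power with sides in the family [B]; a list of pairs
    constrains finitely many coordinates. *)
Definition box (j : seq (nat * T)) : set (nat -> X) :=
  [set f | forall p, p \in j -> B p.2 (f p.1)].

Variable JJ : set (seq (nat * T)).
Hypothesis JJ_cover : forall f, (forall k, F (f k)) -> exists2 j, JJ j & box j f.

(** The value is [false] because the point of the cube given by [x] contains the
    indices of the members of [B] that miss [x]. *)
Let tbox (j : seq (nat * T)) : set (nat -> T -> bool) :=
  [set t | forall p, p \in j -> t p.1 p.2 = false].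

(** Only the first [n] coordinates are constrained: [thin 0] is the statement to
    be proved, and passing from [n] to [n.+1] adds one factor to a product. *)
Let thin n (S : nat -> set (T -> bool)) := exists JJ' : set (seq (nat * T)),
  [/\ JJ' `<=` JJ, countable JJ' & forall t, (forall k, V (t k)) ->
    (forall k, (k < n)%N -> S k (t k)) -> exists2 j, JJ' j & tbox j t].

Let thick n (C : nat -> set (T -> bool)) := forall r : nat -> code T,
  (forall k, (k < n)%N -> C k `<=` Dset (r k)) -> ~ thin n (fun k => Dset (r k)).

Let upd (C : nat -> set (T -> bool)) n D k := if k == n then D else C k.

Lemma thin_sub n S S' : (forall k, (k < n)%N -> S k `<=` S' k) -> thin n S' -> thin n S.
Proof.
move=> SS [JJ' [sJ cJ cov]]; exists JJ'; split=> // t tV tS.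
by apply: cov => // k kn; apply: SS => //; exact: tS.
Qed.

(** If no [D] worked, the sets [S] such that some product of coded
    neighbourhoods of the first [n] sets, multiplied by [S], is thin would form
    a sigma-ideal to which the theorem of Alster applies.  Countable unions are
    the reason for working with neighbourhoods that are countable
    intersections of clopen sets. *)
Lemma thick_step n C : thick n C ->
  exists D, [/\ cylclosed D, D `<=` V & thick n.+1 (upd C n D)].
Proof.
move=> thC; apply: contrapT => /forallNP nD.
pose Sm S := exists r : nat -> code T,
  (forall k, (k < n)%N -> C k `<=` Dset (r k)) /\
  thin n.+1 (upd (fun k => Dset (r k)) n S).
have [|||r [rC [JJ' [sJ cJ cov]]]] := @alster T R omega1R en en_surj X F B hX closedF openB Sm.
- move=> A A' AA [r [rC thr]]; exists r; split=> //; apply: thin_sub thr => k _.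
  by rewrite /upd; case: eqP => _; [exact: AA|exact: subset_refl].
- move=> A /choice [r rP].
  exists (fun k => cmeet (fun m => r m k)); split.
    by move=> k kn u Cu; rewrite cmeetE => m _; have [+ _] := rP m; move/(_ k kn); apply.
  have /choice [J JP] : forall m, exists JJ' : set (seq (nat * T)),
      [/\ JJ' `<=` JJ, countable JJ' & forall t, (forall k, V (t k)) ->
      (forall k, (k < n.+1)%N -> upd (fun k => Dset (r m k)) n (A m) k (t k)) ->
      exists2 j, JJ' j & tbox j t].
    by move=> m; have [_] := rP m.
  exists (\bigcup_m J m); split.
  + by move=> j [m _ Jj]; have [+ _ _] := JP m; apply.
  + by apply: bigcup_countable => // m _; have [] := JP m.
  move=> t tV tS; have : (\bigcup_m A m) (t n) by have := tS n (ltnSn n); rewrite /upd eqxx.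
  move=> [m _ Am]; have [_ _ cov] := JP m.
  have [||j Jj jt] := cov t => //; last by exists j => //; exists m.
  move=> k kn; have := tS k kn; rewrite /upd; case: eqP => [->//|_].
  by rewrite cmeetE; apply.
- move=> D cD DV; have /not_and3P := nD D; case; [by []| by [] |].
  move=> /existsNP [r /not_implyP [rC /contrapT thr]].
  exists (r n); first by have := rC n (ltnSn n); rewrite /upd eqxx.
  exists r; split.
    move=> k kn; have := rC k (ltnW kn); rewrite /upd.
    by case: eqP kn => [->|//]; rewrite ltnn.
  apply: thin_sub thr => k _; rewrite /upd; case: eqP => [-> u []//|_].
  exact: subset_refl.
apply: (thC r rC); exists JJ'; split=> // t tV tS; apply: cov => // k.
rewrite ltnS /upd; case: eqP => // kn; rewrite leq_eqVlt => /orP[/eqP //|]; exact: tS.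
Qed.

(** Otherwise choose closed subsets [C 0], [C 1], and so on of [V] such that no
    product of coded neighbourhoods of the first [n] of them is thin.  Their
    product is compact, so finitely many boxes cover it, and these cover a
    product of clopen neighbourhoods of finitely many factors. *)
Lemma box_countable_subcover : exists JJ' : set (seq (nat * T)),
  [/\ JJ' `<=` JJ, countable JJ' &
    forall f, (forall k, F (f k)) -> exists2 j, JJ' j & box j f].
Proof.
suff [JJ' [sJ cJ cov]] : thin 0 (fun=> setT).
  exists JJ'; split=> // f Ff.
  have [||j Jj jt] := cov (fun k i => ~~ `[< B i (f k) >]) => //.
    by move=> k; exists (f k) => // i /asboolPn.
  exists j => // p /jt /negbFE /asboolP; exact.
apply: contrapT => nthin.
have thick0 C : thick 0 C by move=> r _; apply: contra_not nthin; exact: thin_sub.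
have /choice [nx nxP] : forall nC : nat * (nat -> set (T -> bool)), exists D,
    thick nC.1 nC.2 -> [/\ cylclosed D, D `<=` V & thick nC.1.+1 (upd nC.2 nC.1 D)].
  move=> [n C] /=; have [/thick_step [D DP]|] := pselect (thick n C); first by exists D.
  by exists set0.
pose fix o n := if n is m.+1 then upd (o m) m (nx (m, o m)) else (fun=> set0).
have thicko n : thick n (o n).
  by elim: n => [|n /(nxP (n, o n)) []]; first exact: thick0.
pose C n := nx (n, o n).
have oC n k : (k < n)%N -> o n k = C k.
  elim: n => // n ih; rewrite ltnS /= /upd; case: eqP => [-> //|kn].
  by rewrite leq_eqVlt => /orP[/eqP //|]; exact: ih.
have [cC CV] : (forall k, cylclosed (C k)) /\ (forall k, C k `<=` V).
  by split=> k; have [] := nxP (k, o k) (thicko k).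
have thickC n : thick n C.
  move=> r rC; apply: thicko => k kn; rewrite oC //; exact: rC.
have neC k : C k !=set0.
  apply/set0P/eqP => Ck0.
  pose r l : code T := if l == k then (fun=> Some [::]) else (fun=> None).
  apply: (thickC k.+1 r).
    by move=> l _; rewrite /r; case: eqP => [->|_]; rewrite ?Ck0 // => u _ n s.
  exists set0; split=> // t _ /(_ k (ltnSn k)).
  by rewrite /r eqxx => /(_ 0%N [::] erefl); case.
pose P : set (nat * T -> bool) := [set u | forall k, C k (fun i => u (k, i))].
have cP : cylclosed P.
  move=> u /existsNP [k /(cC k) [s su sC]].
  exists [seq ((k, p.1), p.2) | p <- s]; first by rewrite /cyl /= all_map.
  move=> v sv /(_ k); apply: sC.
  by move: sv; rewrite /cyl /= all_map.
pose sj (j : seq (nat * T)) := [seq (p, false) | p <- j].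
have sjE j u : cyl (sj j) u <-> forall p, p \in j -> u p = false.
  rewrite /cyl /= all_map; split; first by move=> /allP h p pj; apply/eqP/(h p pj).
  by move=> h; apply/allP => p pj /=; apply/eqP/h.
have [|L LS LC] := cyl_compact cP (S := sj @` JJ).
  move=> u Pu.
  have /choice [x xP] : forall k, exists x, F x /\ forall i, u (k, i) -> ~ B i x.
    by move=> k; have [x Fx xu] := CV k _ (Pu k); exists x.
  have [|j Jj jx] := JJ_cover (f := x); first by move=> k; exact: (xP k).1.
  exists (sj j); first by exists j.
  apply/sjE => -[k i] pj; apply/negP => /(xP k).2; apply.
  exact: jx (k, i) pj.
(* Modifying the coordinates outside D does not affect the boxes in L. *)
pose Phi := unzip1 (flatten L).
pose D := [set p.2 | p in [set` Phi]].
have cD : countable D by apply: countable_imageT; exact: countable_seq_list.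
have /choice [r rP] : forall k, exists c, Dset c = sat D (C k).
  by move=> k; have [c _ e] := sat_code cD (cC k); exists c.
have bounded (l : seq (nat * T)) : exists n, forall p, p \in l -> (p.1 < n)%N.
  elim: l => [|p l [n nP]]; first by exists 0%N.
  exists (maxn p.1.+1 n) => q; rewrite inE => /orP[/eqP ->|/nP]; first exact: leq_maxl.
  by move=> qn; apply: leq_trans qn (leq_maxr _ _).
have [n nP] := bounded Phi.
apply: (thickC n r); first by move=> k _; rewrite rP; exact: sub_sat.
exists [set j | JJ j /\ sj j \in L]; split.
- by move=> j [].
- apply: (countable_inj_on (f := sj) (countable_seq_list L)); first by move=> j [].
  by move=> j j' _ _; apply: inj_map => p q [].
move=> t tV tS.
have /choice [v vP] : forall k, exists v, C k v /\ ((k < n)%N -> agree D (t k) v).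
  move=> k; case kn : (k < n)%N; last by have [v Cv] := neC k; exists v.
  by have := tS k kn; rewrite rP => -[v Cv tv]; exists v.
have [|s sL su] := LC (fun p => v p.1 p.2); first by move=> k; exact: (vP k).1.
have [j Jj e] := LS s sL; exists j; first by split=> //; rewrite e.
move: su; rewrite -e => /sjE ju p pj.
have pPhi : p \in Phi.
  apply/mapP; exists (p, false) => //; apply/flattenP; exists s => //.
  by rewrite -e; apply/mapP; exists p.
by rewrite -(ju p pj); apply: ((vP p.1).2 (nP p pPhi)); exists p.
Qed.

End Power.

(** * Families of size continuum *)

Definition embeds_continuum (U : Type) := exists f : U -> set nat, injective f.

Lemma set_eq_at (U : Type) (x : U) (A A' : set U) : A = A' -> A x = A' x.
Proof. by move=> ->. Qed.

Lemma embeds_inj (U U' : Type) (f : U -> U') :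
  injective f -> embeds_continuum U' -> embeds_continuum U.
Proof. by move=> fi [g gi]; exists (g \o f); exact: inj_comp. Qed.

Lemma embeds_set (N : countType) : embeds_continuum (set N).
Proof.
exists (fun A => pickle @` A) => A A' e; apply/seteqP; split=> n An.
  have : (pickle @` A) (pickle n) by exists n.
  by rewrite e => -[m Am /(pcan_inj pickleK) <-].
have : (pickle @` A') (pickle n) by exists n.
by rewrite -e => -[m Am /(pcan_inj pickleK) <-].
Qed.

Lemma embeds_fun (U : Type) : embeds_continuum U -> embeds_continuum (nat -> U).
Proof.
move=> [f fi]; apply: (@embeds_inj _ (set (nat * nat))
  (fun u => [set p | f (u p.1) p.2])); last exact: embeds_set.
move=> u u' e; apply/funext => n; apply: fi; apply/funext => k.
exact: (set_eq_at (n, k) e).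
Qed.

Lemma embeds_prod (U U' : Type) :
  embeds_continuum U -> embeds_continuum U' -> embeds_continuum (U * U').
Proof.
move=> [f fi] [g gi]; apply: (@embeds_inj _ (set (nat + nat))
  (fun u x => match x with inl n => f u.1 n | inr n => g u.2 n end)); last exact: embeds_set.
move=> [u v] [u' v'] e; congr pair.
  by apply: fi; apply/funext => n; exact: (set_eq_at (inl n) e).
by apply: gi; apply/funext => n; exact: (set_eq_at (inr n) e).
Qed.

Lemma embeds_option (U : Type) : embeds_continuum U -> embeds_continuum (option U).
Proof.
move=> [f fi]; apply: (@embeds_inj _ (set (option nat))
  (fun o x => match o, x with
    | None, _ => False | Some _, None => True | Some u, Some n => f u n end));
  last exact: embeds_set.
move=> [u|] [u'|] e //.
- congr Some; apply: fi; apply/funext => n.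
  exact: (set_eq_at (Some n) e).
- by have := set_eq_at None e; rewrite /= => E; exfalso; rewrite -E.
- by have := set_eq_at None e; rewrite /= => E; exfalso; rewrite E.
Qed.

Lemma embeds_seq (U : Type) : embeds_continuum U -> embeds_continuum (seq U).
Proof.
move=> /embeds_option /embeds_fun; apply: (@embeds_inj _ _ (@onth U)) => s s' e.
by apply: eq_from_onth => n; rewrite e.
Qed.

Lemma embeds_count (U : countType) : embeds_continuum U.
Proof.
apply: (@embeds_inj _ (set U) set1); last exact: embeds_set.
by move=> x y e; have : [set x] x by []; rewrite e.
Qed.

(** Well-founded trees whose nodes have countably many children and carry
    a label from the continuum: the terms over operations of countable
    arity. *)
Inductive tree := Leaf | Node of nat -> set nat & nat & nat -> nat -> tree.

(** A tree is recovered from the labels found along its finite branches. *)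
Fixpoint tree_code (t : tree) : set (seq (nat * nat) * option (nat + nat * nat)) :=
  match t with
  | Leaf => set0
  | Node r m f => fun p => match p with
    | ([::], None) => True
    | ([::], Some (inl k)) => k = m
    | ([::], Some (inr (n, k))) => r n k
    | (nk :: s, l) => tree_code (f nk.1 nk.2) (s, l)
    end
  end.

Lemma tree_code_inj : injective tree_code.
Proof.
elim=> [|r m f ih] [|r' m' f'] // e.
- by have := set_eq_at ([::], None) e; rewrite /= => E; exfalso; rewrite E.
- by have := set_eq_at ([::], None) e; rewrite /= => E; exfalso; rewrite -E.
have er : r = r'.
  apply/funext => n; apply/funext => k.
  exact: (set_eq_at ([::], Some (inr (n, k))) e).
have em : m = m'.
  have := set_eq_at ([::], Some (inl m)) e.
  by rewrite /= => <-.
rewrite er em; congr Node; apply/funext => n; apply/funext => k; apply: ih.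
apply/funext => -[s l].
exact: (set_eq_at ((n, k) :: s, l) e).
Qed.

Lemma embeds_tree : embeds_continuum tree.
Proof. apply: embeds_inj tree_code_inj _; exact: embeds_set. Qed.

Section Reduction.
Variables (T : choiceType) (R : rel T).
Hypothesis omega1R : is_omega1 R.
Variable (toT : set nat -> T) (ofT : T -> set nat).
Hypotheses (toT_inj : injective toT) (ofT_inj : injective ofT).

Lemma continuum_enum (U : Type) (u0 : U) : embeds_continuum U ->
  exists g : T -> U, forall u, exists i, g i = u.
Proof.
move=> [f fi].
have /choice [g gP] : forall i, exists u, forall u', toT (f u') = i -> u = u'.
  move=> i; have [[u <-]|nu] := pselect (exists u, toT (f u) = i).
    by exists u => u' /toT_inj /fi.
  by exists u0 => u' e; case: nu; exists u'.
by exists g => u; exists (toT (f u)); exact: gP.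
Qed.

Variable X : topologicalType.
Hypothesis hX : productively_quasi_lindelof X.

(** Suppose that no countable subfamily of [W] covers.  Choose for every
    countable subfamily an uncovered point, and close off under this choice:
    there is a set [A] of at most continuum many points such that for every
    countable family of members of [W], each meeting the power of [A], the
    chosen uncovered point has its coordinates in [A].  As every
    point lies in at most continuum many members of [W], at most continuum many members of [W] meet the power of [A],
    and since members of [W] are boxes these cover the power of the closure of
    [A].  Countably many of them do so as well, a contradiction. *)
Lemma point_continuum_subcover (W : set (set {ptws nat -> X})) :
  is_cover W -> point_le W continuum -> W `<=` @basic_open X ->
  exists W', [/\ W' `<=` W, countable W' & is_cover W'].
Proof.
move=> Wcov Wpt Wb; apply: contrapT => nW'.
have uncov (W' : set (set (nat -> X))) : W' `<=` W -> countable W' ->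
    exists f, forall w, W' w -> ~ w f.
  move=> sW cW; apply: contrapT => /forallNP nf; apply: nW'; exists W'; split=> //.
  apply/seteqP; split=> // f _; have /existsNP [w /not_implyP [W'w /contrapT wf]] := nf f.
  by exists w.
have [f0 _] := uncov set0 (fun _ => False_ind _) (countable0 _).
have /choice [e eP] : forall a, exists e : set nat -> set (nat -> X),
    (forall r, W (e r)) /\ forall w, W w -> w a -> exists r, e r = w.
  move=> a; have /pcard_injP [h hinj] := Wpt a.
  have : [set: {ptws nat -> X}] a by []; rewrite -Wcov => -[w0 Ww0 w0a].
  have /choice [e eP] : forall r, exists w, [/\ W w & forall w', W w' -> w' a -> h w' = r -> w = w'].
    move=> r; have [[w [[Ww wa] <-]]|nw] := pselect (exists w, (W w /\ w a) /\ h w = r).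
      by exists w; split=> // w' Ww' wa' /esym hw; apply: hinj; rewrite ?inE.
    by exists w0; split=> // w' Ww' wa' hw; case: nw; exists w'.
  exists e; split=> [r|w Ww wa]; first by have [] := eP r.
  by exists (h w); have [_] := eP (h w); apply.
have /choice [pt ptP] : forall gr : (nat -> nat -> X) * (nat -> set nat),
    exists f : nat -> X, forall n, ~ e (gr.1 n) (gr.2 n) f.
  move=> [g r] /=; have [||f fP] := uncov (range (fun n => e (g n) (r n))).
  - by move=> _ [n _ <-]; exact: (eP _).1.
  - exact: countable_imageT.
  by exists f => n; apply: fP; exists n.
pose fix ev t := if t is Node r m f then pt (fun n k => ev (f n k), r) m else f0 0%N.
pose A := range ev.
pose Ix := ((nat -> tree) * set nat)%type.
(* Every member of W meeting the power of A is some wt q. *)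
pose wt (q : Ix) := e (ev \o q.1) q.2.
have /choice [V VP] : forall w : set (nat -> X), exists V : nat -> set X, W w ->
    [/\ forall i, open (V i), finite_set [set i | V i <> setT]
      & w = [set f | forall i, V i (f i)]].
  move=> w; have [/Wb [V VP]|] := pselect (W w); first by exists V.
  by exists (fun=> setT).
have wtW q : W (wt q) by exact: (eP _).1.
have [ix ixP] : exists ix : T -> Ix * nat, forall q, exists i, ix i = q.
  apply: (continuum_enum ((fun=> Leaf, set0), 0%N)).
  apply: embeds_prod; last exact: embeds_count.
  apply: embeds_prod; last exact: embeds_set.
  exact: embeds_fun embeds_tree.
have [si siP] := choice ixP.
pose B i := V (wt (ix i).1) (ix i).2.
have oB i : open (B i) by have [+ _ _] := VP _ (wtW (ix i).1); apply.
have /choice [l lP] : forall q, exists l : seq nat, forall k, k \notin l -> V (wt q) k = setT.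
  move=> q.
  have [_ /finite_seqP [s sE] _] := VP _ (wtW q); exists s => k ks.
  by apply: contrapT => nV; move/negP: ks; apply; have : [set` s] k by rewrite -sE.
pose jq q := [seq (k, si (q, k)) | k <- l q].
have jqE q f : box B (jq q) f <-> wt q f.
  have [_ _ E] := VP _ (wtW q); have -> : wt q f <-> forall k, V (wt q) k (f k) by rewrite {1}E.
  split=> [bf k|wf p].
    have [kl|/lP ->//] := boolP (k \in l q).
    have := bf (k, si (q, k)); rewrite /B /= siP; apply.
    by apply/mapP; exists k.
  by move=> /mapP [k kl ->]; rewrite /B /= siP; exact: wf.
have [en en_surj] := continuum_enum ((fun=> None) : code T) (embeds_fun (embeds_option
  (embeds_seq (embeds_prod (ex_intro _ ofT ofT_inj) (embeds_count bool))))).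
have [|JJ' [sJ cJ cov]] := box_countable_subcover omega1R en_surj hX (@closed_closure _ A) oB (JJ := range jq).
  move=> f Af; have : [set: {ptws nat -> X}] f by []; rewrite -Wcov => -[w Ww wf].
  have [oV _ wE] := VP w Ww.
  have wP g : w g <-> forall k, V w k (g k) by rewrite {1}wE.
  have Vf := (wP f).1 wf.
  have /choice [h hP] : forall k, exists t, V w k (ev t).
    move=> k; have [|_ [[t _ <-] Vt]] := Af k (V w k); last by exists t.
    by apply: open_nbhs_nbhs; split.
  have [|r er] := (eP (ev \o h)).2 w Ww; first exact/wP.
  exists (jq (h, r)); first by exists (h, r).
  by apply/jqE; rewrite /wt /= er.
have [c cP] := countable_enum cJ.
have /choice [q qP] : forall n, exists q, forall j, c n = Some j -> j = jq q.
  move=> n; case E : (c n) => [j|]; last by exists (fun=> Leaf, set0).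
  have [|q _ <-] := sJ j; first by apply/cP; exists n.
  by exists q => _ [<-].
pose f := pt (fun n => ev \o (q n).1, fun n => (q n).2).
have [|j /cP [n cn] jf] := cov f.
  move=> k; apply: subset_closure.
  by exists (Node (fun n => (q n).2) k (fun n => (q n).1)).
by apply: (ptP (fun n => ev \o (q n).1, fun n => (q n).2) n); apply/jqE; rewrite -(qP n j cn).
Qed.

End Reduction.

Theorem theorem7p2 (CH : continuum_hypothesis) (X : topologicalType)
    (hX : productively_quasi_lindelof X)
    (href : forall C : set (set {ptws nat -> X}), open_cover C ->
       exists W : set (set {ptws nat -> X}),
         [/\ refinement W C, point_le W continuum & W `<=` @basic_open X]) :
  powerfully_quasi_lindelof X.
Proof.
case: CH => T [R [omega1R cT]] C oC.
have [W [[Wcov WC] Wpt Wb]] := href C oC.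
have [toT toTi] : exists f : set nat -> {classic T}, injective f.
  have /card_eqPle [/pcard_surjP [g gsurj] _] := cT.
  have /choice [f fK] : forall r, exists x, g x = r by move=> r; have [x _] := gsurj r I; exists x.
  by exists f; exact: can_inj fK.
have [ofT ofTi] : exists f : {classic T} -> set nat, injective f.
  have /card_eqPle [_ /pcard_injP [g ginj]] := cT.
  by exists g => x y; apply: ginj; rewrite inE.
have [W' [sW cW covW]] := point_continuum_subcover
  (omega1R : @is_omega1 {classic T} R) toTi ofTi hX Wcov Wpt Wb.
have /choice [U UP] : forall w, exists U, W' w -> C U /\ w `<=` U.
  move=> w; have [/sW /WC [U CU wU]|] := pselect (W' w); first by exists U.
  by exists setT.
exists (U @` W'); split.
- by move=> _ [w W'w <-]; exact: (UP w W'w).1.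
- exact: countable_imageT.
apply/seteqP; split=> // f _; have : setT f by [].
rewrite -covW => -[w W'w wf]; exists (U w); first by exists w.
exact: (UP w W'w).2.
Qed.
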